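(* Let $n\ge 1$ and let $v=(v_0,v_1,\dots,v_n,v_{n+1})$ be a sequence of vectors in $\mathbb{R}^2$ with $v_0=\begin{pmatrix}0\\ 1\end{pmatrix}$, $v_i=\begin{pmatrix}a_i\\ b_i\end{pmatrix}$ for $1\le i\le n$, $v_{n+1}=\begin{pmatrix}1\\ 0\end{pmatrix}$, such that $\det(v_i,v_{i+1})\neq 0$ for every $i=0,\dots,n$. Let $A$ be the real symmetric $n\times n$ matrix whose $(i,j)$ entry is $a_ib_j$ for $i\le j$. Then $$\mathrm{Sign}(A)=4R(v)-S(v).$$
   Context: For a real symmetric matrix $A$, $\mathrm{Sign}(A)$ is the number of positive eigenvalues minus the number of negative eigenvalues (counted with multiplicity). Here $\det(u,w)$ is the determinant of the $2\times 2$ matrix with columns $u,w$, and $\mathrm{sgn}(a)=1$ if $a>0$, $-1$ if $a<0$. $S(v)=1+\sum_{i=0}^{n}\mathrm{sgn}(\det(v_i,v_{i+1}))$. $R(v)$ is the rotation number of $v$ around the origin: each $v_i$ is understood to rotate toward $v_{i+1}$ through the angle of absolute value less than $\pi$, and $R(v)$ is the (integer) number of counterclockwise turns around the origin made by the closed sequence $v_0,v_1,\dots,v_n,v_{n+1},v_0$. Explicitly, if $\theta_i\in(-\pi,\pi)$ is the signed (counterclockwise positive) angle from $v_i$ to $v_{i+1}$ for $0\le i\le n$, then $R(v)=\frac{1}{2\pi}\left(\sum_{i=0}^{n}\theta_i+\frac{\pi}{2}\right)$, the last $\frac{\pi}{2}$ being the angle from $v_{n+1}$ to $v_0$. *)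

(* Defs.v *)
From HB Require Import structures.
From mathcomp Require Import all_boot all_order all_algebra.
From mathcomp Require Import reals trigo.
From mathcomp Require Import polyrcf.
From mathcomp Require Import ring lra.

Set Implicit Arguments.
Unset Strict Implicit.
Unset Printing Implicit Defensive.

Import Order.TTheory GRing.Theory Num.Theory.
Local Open Scope ring_scope.

(* Eigenvalues are the roots of the characteristic polynomial, counted with
   their multiplicity [mup x] as roots; [rootsR p] lists the distinct roots of
   [p] lying in [R] (for a symmetric matrix, these are all its roots). *)
Definition num_pos_eigen (R : rcfType) (n : nat) (A : 'M[R]_n) : nat :=
  (\sum_(x <- rootsR (char_poly A) | (0 < x)%R) mup x (char_poly A))%N.

Definition num_neg_eigen (R : rcfType) (n : nat) (A : 'M[R]_n) : nat :=
  (\sum_(x <- rootsR (char_poly A) | (x < 0)%R) mup x (char_poly A))%N.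

Definition signature (R : rcfType) (n : nat) (A : 'M[R]_n) : int :=
  (num_pos_eigen A)%:Z - (num_neg_eigen A)%:Z.

Definition vec2 (R : realType) (a b : R) : 'cV[R]_2 :=
  \col_(i < 2) (if i == 0 then a else b).

Definition det2 (R : realType) (u w : 'cV[R]_2) : R :=
  \det (row_mx u w : 'M[R]_2).

Definition dot2 (R : realType) (u w : 'cV[R]_2) : R := (u^T *m w) 0 0.

(* The Euclidean norm; the library norm on matrices is the sup norm. *)
Definition norm2 (R : realType) (u : 'cV[R]_2) : R := Num.sqrt (dot2 u u).

(* The counterclockwise-positive angle from [u] to [w], in ]-pi, pi[ when
   [det2 u w != 0]: see [signed_angleP].  The value is 0 when [det2 u w = 0],
   which is not meaningful for opposite vectors. *)
Definition signed_angle (R : realType) (u w : 'cV[R]_2) : R :=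
  Num.sg (det2 u w) * acos (dot2 u w / (norm2 u * norm2 w)).

Definition rotation2 (R : realType) (t : R) : 'M[R]_2 :=
  \matrix_(i < 2, j < 2)
    (if i == j then cos t else if i == 0 then - sin t else sin t).

(* The summand [pi / 2] is the angle from v_(n+1) = (1, 0) back to
   v_0 = (0, 1). *)
Definition rotation_number (R : realType) (n : nat)
    (v : n.+2.-tuple 'cV[R]_2) : R :=
  (\sum_(i < n.+1) signed_angle v`_i v`_i.+1 + pi / 2) / (2 * pi).

Definition sgn_sum (R : realType) (n : nat) (v : n.+2.-tuple 'cV[R]_2) : int :=
  1 + \sum_(i < n.+1) sgz (det2 v`_i v`_i.+1).

(* Matrix indices run from 0: the row and column of index [i] correspond to
   the vector v_(i+1).  The second branch is forced by symmetry. *)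
Definition vec_matrix (R : realType) (n : nat) (v : n.+2.-tuple 'cV[R]_2) :
    'M[R]_n :=
  \matrix_(i < n, j < n)
    (let a k := (v`_k : 'cV[R]_2) 0 0 in
     let b k := (v`_k : 'cV[R]_2) 1 0 in
     if (i <= j)%N then a i.+1 * b j.+1 else a j.+1 * b i.+1).

Lemma det2E (R : realType) (u w : 'cV[R]_2) :
  det2 u w = u 0 0 * w 1 0 - u 1 0 * w 0 0.
Proof.
have e0 i : (row_mx u w : 'M[R]_2) i 0 = u i 0.
  rewrite -(row_mxEl u w i 0).
  by have -> : lshift 1 (0 : 'I_1) = (0 : 'I_2) by exact/val_inj.
have e1 i : (row_mx u w : 'M[R]_2) i 1 = w i 0.
  rewrite -(row_mxEr u w i 0).
  by have -> : rshift 1 (0 : 'I_1) = (1 : 'I_2) by exact/val_inj.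
rewrite /det2 (expand_det_row _ 0) big_ord_recl big_ord1 /cofactor !det_mx11.
have -> : lift ord0 ord0 = 1 :> 'I_2 by exact/val_inj.
rewrite /row' /col' !(mxE matrix_key).
have -> : lift (0 : 'I_2) (0 : 'I_1) = 1 by exact/val_inj.
have -> : lift (1 : 'I_2) (0 : 'I_1) = 0 by exact/val_inj.
by rewrite !e0 !e1 /=; ring.
Qed.

Lemma dot2E (R : realType) (u w : 'cV[R]_2) :
  dot2 u w = u 0 0 * w 0 0 + u 1 0 * w 1 0.
Proof.
rewrite /dot2 mxE big_ord_recl big_ord1 !mxE.
by have -> : lift ord0 ord0 = 1 :> 'I_2 by exact/val_inj.
Qed.

Lemma signed_angleP (R : realType) (u w : 'cV[R]_2) : det2 u w != 0 ->
  - pi < signed_angle u w < pi /\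
  norm2 u *: w = norm2 w *: (rotation2 (signed_angle u w) *m u).
Proof.
move=> d0.
have lagr : dot2 u w ^+ 2 + det2 u w ^+ 2 = dot2 u u * dot2 w w.
  by rewrite !dot2E det2E; ring.
have u0 : 0 <= dot2 u u by rewrite dot2E; nra.
have w0 : 0 <= dot2 w w by rewrite dot2E; nra.
have p0 : 0 < dot2 u u * dot2 w w.
  have : 0 < det2 u w ^+ 2 by rewrite exprn_even_gt0.
  by rewrite -lagr => ?; have := sqr_ge0 (dot2 u w); lra.
have up : 0 < dot2 u u by rewrite lt_neqAle u0 andbT eq_sym; apply: contraTneq p0 => ->; rewrite mul0r ltxx.
have wp : 0 < dot2 w w by rewrite lt_neqAle w0 andbT eq_sym; apply: contraTneq p0 => ->; rewrite mulr0 ltxx.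
have nu : 0 < norm2 u by rewrite sqrtr_gt0.
have nw : 0 < norm2 w by rewrite sqrtr_gt0.
have nu2 : norm2 u ^+ 2 = dot2 u u by rewrite sqr_sqrtr.
have nw2 : norm2 w ^+ 2 = dot2 w w by rewrite sqr_sqrtr.
set N := norm2 u * norm2 w.
have N0 : 0 < N by rewrite mulr_gt0.
set c := dot2 u w / N; set s := det2 u w / N.
have cs : c ^+ 2 + s ^+ 2 = 1.
  by rewrite /c /s !expr_div_n -mulrDl lagr -nu2 -nw2 -exprMn divff // gt_eqF // exprn_gt0.
have s2 : 0 < s ^+ 2 by rewrite exprn_even_gt0 //= mulf_neq0 // invr_neq0 // gt_eqF.
have c1 : -1 < c < 1 by apply/andP; split; nra.
have c1' : -1 <= c <= 1 by case/andP: c1 => *; rewrite !ltW.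
have ca : c \in `[-1, 1] by rewrite in_itv.
have a_ge0 := acos_ge0 c1'.
have a_lt : acos c < pi by apply: acos_ltpi; case/andP: c1 => -> /ltW ->.
have sgd : Num.sg (det2 u w) = 1 \/ Num.sg (det2 u w) = -1.
  by case: (ltgtP (det2 u w) 0) d0 => // h _; [right; rewrite ltr0_sg|left; rewrite gtr0_sg].
have cosE : cos (signed_angle u w) = c.
  by rewrite /signed_angle -/N -/c; case: sgd => ->; rewrite ?mulN1r ?cosN ?mul1r acosK.
have sinE : sin (signed_angle u w) = s.
  have -> : sin (signed_angle u w) = Num.sg (det2 u w) * sin (acos c).
    by rewrite /signed_angle -/N -/c; case: sgd => ->; rewrite ?mulN1r ?sinN ?mul1r.
  rewrite sin_acos // -cs addrAC subrr add0r sqrtr_sqr /s normrM mulrA -numEsg.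
  by rewrite ger0_norm // invr_ge0 ltW.
split.
  rewrite /signed_angle -/N -/c.
  by case: sgd => ->; rewrite ?mulN1r ?mul1r; apply/andP; split; lra.
have Nu : norm2 u != 0 by rewrite gt_eqF.
have Nw : norm2 w != 0 by rewrite gt_eqF.
apply/matrixP => i j; rewrite !ord1 !mxE big_ord_recl big_ord1 !mxE.
have -> : lift ord0 ord0 = 1 :> 'I_2 by exact/val_inj.
rewrite cosE sinE /c /s /N det2E dot2E.
move: nu2; rewrite dot2E => nu2.
have [->|->] : i = 0 \/ i = 1 by case: i => [[|[|]]] // hi; [left|right]; exact/val_inj.
- rewrite /=; apply: (mulfI Nu); rewrite mulrA -expr2 nu2; field; exact/andP.
- rewrite /=; apply: (mulfI Nu); rewrite mulrA -expr2 nu2; field; exact/andP.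
Qed.

(* Main.v *)
(* Write v_k = (a_k, b_k), d_k = det(v_k, v_(k+1)) and c_k = b_k / a_k; both
   sides are equal to - sum_k sgn (d_k a_k a_(k+1)).

   When no a_k vanishes, subtracting a_1 / a_2 times the second row and
   column of A from the first ones splits off the 1 x 1 block - a_1 d_1 / a_2,
   and what remains is the matrix of v_2, ..., v_n.
   When a_2 = 0, the first two rows and columns split off a hyperbolic plane,
   of signature 0.  By the spectral theorem and Sylvester's law of inertia the
   signature may be read off any diagonal form.

   The angle from v_k to v_(k+1) is atan c_(k+1) - atan c_k plus a half turn of
   sign d_k when the y-axis is crossed; the arctangents telescope. *)
Require Import Defs.
From HB Require Import structures.
From mathcomp Require Import all_boot all_order all_algebra.
From mathcomp Require Import reals trigo.
From mathcomp Require Import polyrcf complex spectral.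
From mathcomp Require Import ring lra.

Set Implicit Arguments.
Unset Strict Implicit.
Unset Printing Implicit Defensive.

Import Order.TTheory GRing.Theory Num.Theory.
Local Open Scope ring_scope.

Lemma mup_prod_XsubC (F : fieldType) n (d : 'I_n -> F) (x : F) :
  mup x (\prod_i ('X - (d i)%:P)) = (\sum_i (d i == x))%N.
Proof.
elim: n d => [|n IH] d; first by rewrite !big_ord0 mupNroot // root1.
rewrite !big_ord_recl mupM ?polyXsubC_eq0 ?IH //; last first.
  by rewrite prodf_seq_neq0; apply/allP => i _; rewrite polyXsubC_eq0.
by rewrite -[X in mup x X]expr1 mup_XsubCX eq_sym; case: eqP.
Qed.

Lemma sum_mup_rootsR (R : rcfType) n (d : 'I_n -> R) (P : pred R) :
  let p := \prod_i ('X - (d i)%:P) in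
  (\sum_(x <- rootsR p | P x) mup x p = #|[set i | P (d i)]|)%N.
Proof.
move=> p; have p0 : p != 0.
  by rewrite prodf_seq_neq0; apply/allP => i _; rewrite polyXsubC_eq0.
have memr i : d i \in rootsR p.
  have := roots_on_rootsR p0 (d i); rewrite in_itv /= => <-.
  by rewrite /p (bigD1 i) //= rootM root_XsubC eqxx.
rewrite (eq_bigr _ (fun x _ => mup_prod_XsubC d x)) exchange_big /=.
rewrite -sum1_card [RHS]big_mkcond /=; apply: eq_bigr => i _.
rewrite inE -big_filter (eq_bigr (fun x => (x == d i) : nat)); last first.
  by move=> x _; rewrite eq_sym.
rewrite -big_mkcond sum1_count count_uniq_mem ?filter_uniq ?uniq_roots //.
by rewrite mem_filter memr andbT; case: (P _).
Qed.

Section Inertia.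
Variable C : numClosedFieldType.
Local Open Scope sesquilinear_scope.

Lemma diag_form n (x d : 'rV[C]_n) :
  (x *m diag_mx d *m x^t*) 0 0 = \sum_i d 0 i * `|x 0 i| ^+ 2.
Proof.
rewrite mxE; apply: eq_bigr => i _.
by rewrite mul_mx_diag !mxE mulrAC -normCK mulrC.
Qed.

(* If d had more positive entries than e, then a nonzero vector would satisfy
   the #{d <= 0} + #{e > 0} < n linear conditions putting it in the subspace
   where the first diagonal form is positive and the second nonpositive. *)
Lemma inertia_le n (A P Q : 'M[C]_n) (d e : 'rV[C]_n) :
  P \in unitmx -> Q \in unitmx -> d \is a realmx -> e \is a realmx ->
  P *m A *m P^t* = diag_mx d -> Q *m A *m Q^t* = diag_mx e ->
  (#|[set i | 0 < d 0 i]%R| <= #|[set i | 0 < e 0 i]%R|)%N.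
Proof.
move=> uP uQ rd re EP EQ; rewrite leqNgt; apply/negP => lt.
pose Dn := ~: [set i | 0 < d 0 i]; pose Ep := [set i | 0 < e 0 i].
pose K : 'M[C]_(n, #|Dn| + #|Ep|) :=
  row_mx (\matrix_(i, j) (i == enum_val j)%:R)
         (\matrix_(i, j) (P *m invmx Q) i (enum_val j)).
have rK : (\rank K < n)%N.
  apply: leq_ltn_trans (rank_leq_col K) _; rewrite /Dn.
  rewrite -[X in (_ < X)%N](card_ord n) -(cardsC [set i | 0 < d 0 i]).
  by rewrite addnC ltn_add2r.
have : kermx K != 0 by rewrite -mxrank_eq0 mxrank_ker -lt0n subn_gt0.
case/rowV0Pn => x /sub_kermxP; rewrite mul_mx_row => xK x0.
have [xD xE] : x *m (\matrix_(i, j) (i == enum_val j)%:R : 'M_(_, #|Dn|)) = 0 /\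
  x *m (\matrix_(i, j) (P *m invmx Q) i (enum_val j) : 'M_(_, #|Ep|)) = 0.
  by apply: eq_row_mx; rewrite xK row_mx0.
have {}xD i : ~~ (0 < d 0 i) -> x 0 i = 0.
  move=> hi; have iD : i \in Dn by rewrite !inE.
  move/matrixP/(_ 0 (enum_rank_in iD i)): xD; rewrite !mxE => E; rewrite -[RHS]E.
  rewrite (bigD1 i) //= big1 ?addr0 => [|j ji]; rewrite mxE enum_rankK_in //.
    by rewrite eqxx mulr1.
  by rewrite (negPf ji) mulr0.
pose z := x *m P *m invmx Q.
have {}xE i : 0 < e 0 i -> z 0 i = 0.
  move=> hi; have iE : i \in Ep by rewrite inE.
  have := congr1 (fun X : 'rV_ _ => X 0 (enum_rank_in iE i)) xE.
  rewrite /= [in RHS]mxE => <-; rewrite /z -mulmxA [LHS]mxE [RHS]mxE.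
  by apply: eq_bigr => j _; rewrite [in RHS]mxE enum_rankK_in.
have eqf : (x *m diag_mx d *m x^t*) 0 0 = (z *m diag_mx e *m z^t*) 0 0.
  congr (fun_of_matrix _ 0 0); rewrite -EP -EQ.
  have zQ : z *m Q = x *m P by rewrite mulmxKV.
  have : z *m Q *m A *m (z *m Q)^t* = x *m P *m A *m (x *m P)^t* by rewrite zQ.
  by rewrite !trmx_mul !map_mxM !mulmxA => ->.
have /rV0Pn[i xi0] := x0.
have di : 0 < d 0 i by apply: contraNT xi0 => /xD ->.
suff : 0 < 0 :> C by rewrite ltxx.
apply: (@lt_le_trans _ _ ((x *m diag_mx d *m x^t*) 0 0)).
  rewrite diag_form (bigD1 i) //= ltr_pwDl //.
    by rewrite mulr_gt0 // exprn_gt0 // normr_gt0.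
  apply: sumr_ge0 => j _; case: (boolP (0 < d 0 j)) => [dj|/xD ->].
    by rewrite mulr_ge0 ?exprn_ge0 // ltW.
  by rewrite normr0 expr0n mulr0.
rewrite eqf diag_form; apply: sumr_le0 => j _.
case: (boolP (0 < e 0 j)) => [/xE ->|ej]; first by rewrite normr0 expr0n mulr0.
rewrite mulr_le0_ge0 ?exprn_ge0 //.
by rewrite real_leNgt ?real0 //; exact: (mxOverP re).
Qed.

Lemma inertia_eq n (A P Q : 'M[C]_n) (d e : 'rV[C]_n) :
  P \in unitmx -> Q \in unitmx -> d \is a realmx -> e \is a realmx ->
  P *m A *m P^t* = diag_mx d -> Q *m A *m Q^t* = diag_mx e ->
  #|[set i | 0 < d 0 i]| = #|[set i | 0 < e 0 i]|.
Proof.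
move=> uP uQ rd re EP EQ; apply/eqP; rewrite eqn_leq.
by rewrite (inertia_le uP uQ rd re EP EQ) (inertia_le uQ uP re rd EQ EP).
Qed.

End Inertia.

Lemma char_poly_conj (R : comUnitRingType) n (A P : 'M[R]_n) :
  P \in unitmx -> char_poly (invmx P *m A *m P) = char_poly A.
Proof.
move=> uP.
have VP : map_mx (@polyC R) (invmx P) *m map_mx (@polyC R) P = 1%:M.
  by rewrite -map_mxM mulVmx // map_mx1.
have -> : char_poly (invmx P *m A *m P) =
    \det (map_mx (@polyC R) (invmx P) *m char_poly_mx A *m map_mx (@polyC R) P).
  rewrite /char_poly /char_poly_mx mulmxBr mulmxBl !map_mxM.
  by rewrite scalar_mxC -[_%:M *m _ *m _]mulmxA VP mulmx1.
by rewrite !det_mulmx mulrAC -det_mulmx VP det1 mul1r.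
Qed.

Lemma sum_sgz (R : realDomainType) n (d : 'I_n -> R) :
  \sum_i sgz (d i) = #|[set i | 0 < d i]|%:Z - #|[set i | d i < 0]|%:Z.
Proof.
have cardE (P : pred 'I_n) : #|[set i | P i]|%:Z = \sum_i (P i : nat)%:Z.
  rewrite -sum1_card big_mkcond (big_morph Posz PoszD (erefl (0 : int))).
  by apply: eq_bigr => i _; rewrite inE; case: (P i).
rewrite !cardE -sumrB; apply: eq_bigr => i _.
by case: (sgzP (d i)).
Qed.

Section Signature.
Variable R : rcfType.
Local Open Scope sesquilinear_scope.
Local Notation toC := (real_complex R).

Lemma real_spectral n (A : 'M[R]_n) : A^T = A ->
  exists P : 'M[complex R]_n, exists r : 'I_n -> R,
    [/\ P \in unitmx, char_poly A = \prod_i ('X - (r i)%:P) &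
        P *m map_mx toC A *m P^t* = diag_mx (\row_i toC (r i))].
Proof.
move=> symA; pose B := map_mx toC A.
have hB : B \is hermsymmx.
  apply: realsym_hermsym.
    apply/is_hermitianmxP; rewrite expr0 scale1r map_mx_id //.
    by apply/matrixP => i j; rewrite /B -[in LHS]symA !mxE.
  by apply/mxOverP => i j; rewrite mxE; apply/complex_realP; exists (A i j).
have E := orthomx_spectralP (hermitian_normalmx hB).
have rX := hermitian_spectral_diag_real hB.
set P := spectralmx B in E; set X := spectral_diag B in E rX.
have uP : P \in unitmx := spectral_unit B.
exists P, (fun i => complex.Re (X 0 i)).
have rE i : toC (complex.Re (X 0 i)) = X 0 i by apply/RRe_real/(mxOverP rX).
have dE : \row_i toC (complex.Re (X 0 i)) = X.
  by apply/rowP => i; rewrite mxE rE.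
split=> //.
  apply: (map_poly_inj toC); rewrite map_char_poly -/B E char_poly_conj //.
  rewrite char_poly_trig ?diag_mx_is_trig // rmorph_prod; apply: eq_bigr => i _.
  rewrite /= map_polyXsubC mxE -rE eqxx mulr1n; congr (_ - _%:P).
rewrite dE -/B E -invmx_unitary ?spectral_unitarymx //.
by rewrite !mulmxA mulmxV // mul1mx mulmxK.
Qed.

Lemma inertia_real n (A M : 'M[R]_n) (P : 'M[complex R]_n) (r : 'I_n -> R)
    (d : 'rV[R]_n) :
  P \in unitmx -> P *m map_mx toC A *m P^t* = diag_mx (\row_i toC (r i)) ->
  M \in unitmx -> M *m A *m M^T = diag_mx d ->
  #|[set i | 0 < r i]| = #|[set i | 0 < d 0 i]|.
Proof.
move=> uP EP uM EM.
have -> : [set i | 0 < r i] = [set i | 0 < (\row_i toC (r i)) 0 i].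
  by apply/setP => i; rewrite !inE mxE -(rmorph0 toC) ltcR.
have -> : [set i | 0 < d 0 i] = [set i | 0 < (map_mx toC d) 0 i].
  by apply/setP => i; rewrite !inE mxE -(rmorph0 toC) ltcR.
apply: (@inertia_eq _ _ _ P (map_mx toC M) _ _ uP _ _ _ EP).
- by rewrite map_unitmx.
- by apply/mxOverP => i j; rewrite mxE; apply/complex_realP; exists (r j).
- by apply/mxOverP => i j; rewrite mxE; apply/complex_realP; exists (d i j).
rewrite -map_diag_mx -EM !map_mxM /=; congr (_ *m _).
apply/matrixP => i j; rewrite !mxE.
by apply/CrealP/complex_realP; exists (M j i).
Qed.

Lemma signature_congr n (A M : 'M[R]_n) (d : 'rV[R]_n) :
  A^T = A -> M \in unitmx -> M *m A *m M^T = diag_mx d ->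
  signature A = \sum_i sgz (d 0 i).
Proof.
move=> symA uM EM; have [P [r [uP cE EP]]] := real_spectral symA.
rewrite sum_sgz /signature /num_pos_eigen /num_neg_eigen cE.
rewrite !sum_mup_rootsR (inertia_real uP EP uM EM); congr (_ - Posz _).
have -> : [set i | r i < 0] = [set i | 0 < - r i].
  by apply/setP => i; rewrite !inE oppr_gt0.
have -> : [set i | d 0 i < 0] = [set i | 0 < (- d) 0 i].
  by apply/setP => i; rewrite !inE mxE oppr_gt0.
apply: (@inertia_real _ (- A) M P) => //.
  rewrite map_mxN mulmxN mulNmx EP -linearN /=; congr diag_mx.
  by apply/rowP => i; rewrite !mxE rmorphN.
by rewrite mulmxN mulNmx EM -linearN.
Qed.

End Signature.

Definition has_signature (R : realFieldType) n (A : 'M[R]_n) (s : int) : Prop :=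
  exists M : 'M[R]_n, exists d : 'rV[R]_n,
    [/\ M \in unitmx, M *m A *m M^T = diag_mx d & s = \sum_i sgz (d 0 i)].

Lemma has_signature_congr (R : realFieldType) n (A L : 'M[R]_n) s :
  L \in unitmx -> has_signature (L *m A *m L^T) s -> has_signature A s.
Proof.
move=> uL [M [d [uM E ->]]]; exists (M *m L), d; split=> //.
  by rewrite unitmx_mul uM.
by rewrite trmx_mul -E !mulmxA.
Qed.

Lemma has_signature_block (R : realFieldType) m n (A : 'M[R]_m) (B : 'M[R]_n)
    s t : has_signature A s -> has_signature B t ->
  has_signature (block_mx A 0 0 B) (s + t).
Proof.
move=> [M [d [uM EM ->]]] [N [e [uN EN ->]]].
exists (block_mx M 0 0 N), (row_mx d e); split.
- by rewrite unitmxE det_ublock unitrM -!unitmxE uM.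
- rewrite tr_block_mx !trmx0 !mulmx_block !(mulmx0, mul0mx, addr0, add0r).
  by rewrite EM EN diag_mx_row.
- rewrite big_split_ord /=; congr (_ + _); apply: eq_bigr => i _.
    by rewrite row_mxEl.
  by rewrite row_mxEr.
Qed.

Lemma has_signature_schur_dr (R : realFieldType) m n (A : 'M[R]_m)
    (B : 'M[R]_n) (W : 'M[R]_(m, n)) s t : B^T = B ->
  has_signature (A - W *m B *m W^T) s -> has_signature B t ->
  has_signature (block_mx A (W *m B) (W *m B)^T B) (s + t).
Proof.
move=> Bsym hA hB.
apply: (@has_signature_congr _ _ _ (block_mx 1%:M (- W) 0 1%:M)).
  by rewrite unitmxE det_ublock !det1 mulr1 unitr1.
have := has_signature_block hA hB; congr (has_signature _ _).
rewrite tr_block_mx !trmx1 !trmx0 !mulmx_block trmx_mul Bsym linearN /=.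
rewrite !(mulmx0, mul0mx, mulmx1, mul1mx, addr0, add0r, mulNmx, mulmxN).
by rewrite !subrr mul0mx subr0 [W *m (B *m _)]mulmxA.
Qed.

Lemma has_signature_schur_ul (R : realFieldType) m n (A : 'M[R]_m)
    (B : 'M[R]_n) (W : 'M[R]_(m, n)) s t : A^T = A ->
  has_signature A s -> has_signature (B - W^T *m A *m W) t ->
  has_signature (block_mx A (A *m W) (A *m W)^T B) (s + t).
Proof.
move=> Asym hA hB.
apply: (@has_signature_congr _ _ _ (block_mx 1%:M 0 (- W^T) 1%:M)).
  by rewrite unitmxE det_lblock !det1 mulr1 unitr1.
have := has_signature_block hA hB; congr (has_signature _ _).
rewrite tr_block_mx !trmx1 !trmx0 !mulmx_block trmx_mul Asym linearN /= trmxK.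
rewrite !(mulmx0, mul0mx, mulmx1, mul1mx, addr0, add0r, mulNmx, mulmxN).
by rewrite !addNr mul0mx oppr0 add0r mulmxA [B - _]addrC.
Qed.

Lemma has_signature0 (R : realFieldType) (A : 'M[R]_0) : has_signature A 0.
Proof.
exists 1%:M, 0; split; first exact: unitmx1; last by rewrite big_ord0.
by apply/matrixP => - [].
Qed.

Lemma has_signature1 (R : realFieldType) (A : 'M[R]_1) :
  has_signature A (sgz (A 0 0)).
Proof.
exists 1%:M, A; split; first exact: unitmx1; last by rewrite big_ord1.
by rewrite trmx1 mulmx1 mul1mx; apply/matrixP => i j; rewrite !ord1 mxE mulr1n.
Qed.

Lemma ord2P (P : 'I_2 -> Prop) : P 0 -> P 1 -> forall i, P i.
Proof.
move=> P0 P1 [[|[|i]] hi] //.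
  by have -> : Ordinal hi = 0 by exact/val_inj.
by have -> : Ordinal hi = 1 by exact/val_inj.
Qed.

Lemma sum_ord2 (V : nmodType) (F : 'I_2 -> V) : \sum_i F i = F 0 + F 1.
Proof. by rewrite big_ord_recl big_ord1; congr (_ + F _); exact/val_inj. Qed.

(* The rows of the change of basis are two vectors e_0 + t e_1 on which the
   form takes the values 1 and -1. *)
Lemma has_signature_hyperbolic (R : realFieldType) (A : 'M[R]_2) :
  A^T = A -> A 0 1 != 0 -> A 1 1 = 0 -> has_signature A 0.
Proof.
move=> /matrixP/(_ 0 1); rewrite mxE => sym h0 d0.
set c := A 0 0; set h := A 0 1.
pose t (i : 'I_2) : R := ((if i == 0 then 1 else -1) - c) / (2 * h).
exists (\matrix_(i, j) if j == 0 then 1 else t i).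
exists (\row_i if i == 0 then 1 else -1); split.
- rewrite unitmxE (expand_det_row _ 0) big_ord_recl big_ord1 /cofactor !det_mx11.
  have e1 : lift ord0 ord0 = 1 :> 'I_2 by exact/val_inj.
  rewrite e1 !mxE /= unitfE /t /=.
  have -> : 1 * ((-1) ^+ (0 + 0) * ((-1 - c) / (2 * h))) +
     (1 - c) / (2 * h) * ((-1) ^+ (0 + 1) * 1) = - h^-1 by field.
  by rewrite oppr_eq0 invr_eq0.
- apply/matrixP; elim/ord2P; elim/ord2P;
  rewrite !(mxE, sum_ord2) /= sym d0 -/h -/c /t /=; field; exact: h0.
- rewrite big_ord_recl big_ord1 !mxE /= sgz1.
  by rewrite sgzN1 addrN.
Qed.

Definition green_mx (R : realFieldType) n (a b : nat -> R) : 'M[R]_n :=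
  \matrix_(i < n, j < n) (if (i <= j)%N then a i * b j else a j * b i).

Lemma green_mx_sym (R : realFieldType) n (a b : nat -> R) :
  (green_mx n a b)^T = green_mx n a b.
Proof.
apply/matrixP => i j; rewrite !mxE.
by case: (ltngtP i j) => // /val_inj ->.
Qed.

Lemma green_mx_signature (R : realFieldType) n (a b : nat -> R) :
  a 0%N != 0 -> b n = 0 ->
  (forall i, (i < n)%N -> a i * b i.+1 - b i * a i.+1 != 0) ->
  has_signature (green_mx n a b) (- \sum_(i < n)
     sgz (a i * b i.+1 - b i * a i.+1) * sgz (a i * a i.+1)).
Proof.
have [m] := ubnP n; elim: m n a b => // m IH [|n] a b lt_nm a0 bn d0.
  by rewrite big_ord0 oppr0; exact: has_signature0.
have [a1|a1] := eqVneq (a 1%N) 0; last first.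
  have := IH n (fun k => a k.+1) (fun k => b k.+1) lt_nm a1 bn.
  move=> /(_ (fun i hi => d0 i.+1 hi)) hB.
  pose W : 'rV[R]_n := \row_j if val j == 0%N then a 0%N / a 1%N else 0.
  pose B := green_mx n (fun k => a k.+1) (fun k => b k.+1).
  have WB j : (W *m B) 0 j = a 0%N * b j.+1.
    rewrite mxE; case: n @W @B j {lt_nm bn d0 hB} => [|n] W B j; first by case: j.
    rewrite big_ord_recl big1 ?addr0 => [|i _]; last by rewrite !mxE mul0r.
    by rewrite !mxE /= mulrA divfK.
  pose A : 'M[R]_1 := (a 0%N * b 0%N)%:M.
  have -> : green_mx n.+1 a b = block_mx A (W *m B) (W *m B)^T B :> 'M_(1 + n).
    apply/matrixP => i j; case: (split_ordP i) => k ->; case: (split_ordP j) => l ->.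
    - by rewrite block_mxEul mxE !ord1 !mxE mulr1n.
    - by rewrite block_mxEur !ord1 WB mxE.
    - by rewrite block_mxEdl !ord1 [RHS]mxE WB mxE.
    - by rewrite block_mxEdr !mxE.
  rewrite big_ord_recl opprD.
  apply: (@has_signature_schur_dr R 1 n A B W) hB; first exact: green_mx_sym.
  have := has_signature1 (A - W *m B *m W^T); congr has_signature.
  have -> : (A - W *m B *m W^T) 0 0 = - ((a 0%N * b 1%N - b 0%N * a 1%N) * 
       (a 0%N * a 1%N)) * (a 1%N) ^- 2.
    rewrite !mxE mulr1n.
    case: n @W @B WB {lt_nm d0} bn => [|n] W B WB bn.
      by rewrite big_ord0 bn; field.
    rewrite big_ord_recl big1 ?addr0 => [|i _]; last by rewrite !mxE mulr0.
    by rewrite WB !mxE /=; field.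
  rewrite sgzM sgzN sgzM (@gtr0_sgz _ (a 1%N ^- 2)) ?mulr1 //.
  by rewrite invr_gt0 exprn_even_gt0.
case: n lt_nm bn d0 => [|n] lt_nm bn d0.
  by have := d0 0%N isT; rewrite a1 bn !mulr0 subrr eqxx.
have b1 : b 1%N != 0.
  by have := d0 0%N isT; rewrite a1 mulr0 subr0 mulf_eq0 negb_or => /andP[].
have a2 : a 2%N != 0.
  by have := d0 1%N isT; rewrite a1 mul0r sub0r oppr_eq0 mulf_eq0 negb_or => /andP[].
have := IH n (fun k => a k.+2) (fun k => b k.+2) (ltnW lt_nm) a2 bn.
move=> /(_ (fun i hi => d0 i.+2 hi)) hB.
pose W : 'M[R]_(2, n) := \matrix_(i, j) if i == 0 then 0 else b j.+2 / b 1%N.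
pose B := green_mx n (fun k => a k.+2) (fun k => b k.+2).
pose A := green_mx 2 a b.
have AW i j : (A *m W) i j = a i * b j.+2.
  elim/ord2P: i; rewrite !(mxE, sum_ord2) /=; first by field.
  by rewrite a1; field.
have -> : green_mx n.+2 a b = block_mx A (A *m W) (A *m W)^T B :> 'M_(2 + n).
  apply/matrixP => i j; case: (split_ordP i) => k ->; case: (split_ordP j) => l ->.
  - by rewrite block_mxEul !mxE.
  - by rewrite block_mxEur AW mxE /= ltnW // (leq_trans (ltn_ord k)).
  - rewrite block_mxEdl [RHS]mxE AW mxE /=.
    by rewrite leqNgt (leq_trans (ltn_ord l)).
  - by rewrite block_mxEdr !mxE.
rewrite 2!big_ord_recl /= /bump /= a1 !(mulr0, mul0r, sgz0, add0r).
rewrite -[X in has_signature _ X]add0r.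
apply: (@has_signature_schur_ul R 2 n A B W); first exact: green_mx_sym.
  apply: has_signature_hyperbolic; first exact: green_mx_sym.
    by rewrite mxE /= mulf_neq0.
  by rewrite mxE /= a1 mul0r.
rewrite -mulmxA.
have -> : W^T *m (A *m W) = 0.
  apply/matrixP => i j; rewrite [LHS]mxE sum_ord2 !AW !mxE /= a1.
  by rewrite !(mul0r, mulr0, addr0).
by rewrite subr0.
Qed.

Definition slope (R : realType) (u : 'cV[R]_2) : R := u 1 0 / u 0 0.

Lemma norm2_gt0 (R : realType) (u : 'cV[R]_2) :
  (u 0 0 != 0) || (u 1 0 != 0) -> 0 < norm2 u.
Proof.
move=> u0; rewrite sqrtr_gt0 dot2E -!expr2.
by case/orP: u0 => h; [rewrite ltr_wpDr|rewrite ltr_wpDl];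
   rewrite ?sqr_ge0 // exprn_even_gt0.
Qed.

Lemma norm2_x0 (R : realType) (u : 'cV[R]_2) : u 0 0 = 0 ->
  norm2 u = `|u 1 0|.
Proof. by move=> u0; rewrite /norm2 dot2E u0 mul0r add0r -expr2 sqrtr_sqr. Qed.

Lemma slope_x0 (R : realType) (u : 'cV[R]_2) : u 0 0 = 0 -> slope u = 0.
Proof. by move=> u0; rewrite /slope u0 invr0 mulr0. Qed.

Lemma polar_slope (R : realType) (u : 'cV[R]_2) : u 0 0 != 0 ->
  u 0 0 = Num.sg (u 0 0) * norm2 u * cos (atan (slope u)) /\
  u 1 0 = Num.sg (u 0 0) * norm2 u * sin (atan (slope u)).
Proof.
move=> a0.
have E : u 0 0 = Num.sg (u 0 0) * norm2 u * cos (atan (slope u)).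
  have -> : norm2 u = `|u 0 0| * Num.sqrt (1 + slope u ^+ 2).
    rewrite -sqrtr_sqr -sqrtrM ?sqr_ge0 // /norm2 dot2E /slope.
    by congr Num.sqrt; field.
  rewrite cos_atan mulrA -numEsg mulfK // gt_eqF // sqrtr_gt0.
  by rewrite ltr_wpDr ?sqr_ge0.
split=> //; have := atanK (slope u); rewrite /tan => tE.
have -> : sin (atan (slope u)) = slope u * cos (atan (slope u)).
  rewrite -{2}tE divfK //; apply: contra a0 => /eqP c0.
  by rewrite E c0 mulr0.
by rewrite mulrCA -E /slope divfK.
Qed.

Lemma signed_angle_uniq (R : realType) (u w : 'cV[R]_2) (t : R) :
  det2 u w != 0 -> 0 < Num.sg (det2 u w) * t < pi ->
  dot2 u w / (norm2 u * norm2 w) = cos t -> signed_angle u w = t.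
Proof.
move=> d0 /andP[t0 tpi] ct; rewrite /signed_angle ct.
case: sgrP d0 t0 tpi => // _ _; rewrite ?mulN1r ?mul1r => t0 tpi.
  by rewrite cosK // in_itv /= !ltW.
by rewrite -cosN cosK ?opprK // in_itv /= !ltW.
Qed.

(* When a first coordinate is zero, the conventions x / 0 = 0 and
   Num.sg 0 = 0 replace the missing slope by the midpoint of its two one-sided
   limits, and the formula remains correct. *)
Lemma signed_angle_slope (R : realType) (u w : 'cV[R]_2) : det2 u w != 0 ->
  signed_angle u w = atan (slope w) - atan (slope u) +
    pi / 2 * (Num.sg (det2 u w) * (1 - Num.sg (u 0 0 * w 0 0))).
Proof.
move=> d0; have pi0 := pi_gt0 R.
have dE := det2E u w.
have nu : 0 < norm2 u.
  apply: norm2_gt0; apply: contraNT d0; rewrite negb_or !negbK dE.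
  by move=> /andP[/eqP-> /eqP->]; rewrite !mul0r subrr.
have nw : 0 < norm2 w.
  apply: norm2_gt0; apply: contraNT d0; rewrite negb_or !negbK dE.
  by move=> /andP[/eqP-> /eqP->]; rewrite !mulr0 subrr.
have nu0 := lt0r_neq0 nu; have nw0 := lt0r_neq0 nw.
have := atan_gtNpi2 (slope u); have := atan_ltpi2 (slope u).
have := atan_gtNpi2 (slope w); have := atan_ltpi2 (slope w).
have cpi2 : cos (pi / 2 : R) = 0 by rewrite cos_pihalf.
have spi2 : sin (pi / 2 : R) = 1 by rewrite sin_pihalf.
have [a0|a0] := eqVneq (u 0 0) 0.
  have b0 : u 1 0 != 0.
    by apply: contra d0 => /eqP b0; rewrite dE a0 b0 !mul0r subrr.
  have w0 : w 0 0 != 0.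
    by apply: contra d0 => /eqP w0; rewrite dE a0 w0 mulr0 mul0r subrr.
  have sd : Num.sg (det2 u w) = - (Num.sg (u 1 0) * Num.sg (w 0 0)).
    by rewrite dE a0 mul0r add0r sgrN sgrM.
  have [_ wb] := polar_slope w0.
  rewrite (slope_x0 a0) atan0 subr0 a0 mul0r sgr0 subr0 mulr1.
  set g := atan (slope w) in wb * => g1 g2 _ _.
  apply: signed_angle_uniq => //.
    by case: sgrP d0 => // _ _; apply/andP; split; lra.
  rewrite dot2E a0 mul0r add0r norm2_x0 // wb.
  rewrite {1}[u 1 0]numEsg sd.
  have b1 := b0; case: (sgrP (u 1 0)) b0 => // _ _; case: (sgrP (w 0 0)) w0 => // _ _;
  by rewrite ?(mul1r, mulr1, mulN1r, mulrN1, opprK, mulrN, cosD, cosN, sinN)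
       cpi2 spi2; field; rewrite ?oppr_eq0 ?nu0 ?nw0 ?b1.
have [w0|w0] := eqVneq (w 0 0) 0.
  have b0 : w 1 0 != 0.
    by apply: contra d0 => /eqP b0; rewrite dE w0 b0 !mulr0 subrr.
  have sd : Num.sg (det2 u w) = Num.sg (u 0 0) * Num.sg (w 1 0).
    by rewrite dE w0 mulr0 subr0 sgrM.
  have [_ ub] := polar_slope a0.
  rewrite (slope_x0 w0) atan0 sub0r w0 mulr0 sgr0 subr0 mulr1.
  set f := atan (slope u) in ub * => _ _ f1 f2.
  apply: signed_angle_uniq => //.
    by case: sgrP d0 => // _ _; apply/andP; split; lra.
  rewrite dot2E w0 mulr0 add0r (norm2_x0 w0) ub.
  rewrite {1}[w 1 0]numEsg sd.
  have b1 := b0; case: (sgrP (w 1 0)) b0 => // _ _; case: (sgrP (u 0 0)) a0 => // _ _;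
  by rewrite ?(mul1r, mulr1, mulN1r, mulrN1, opprK, mulrN, cosD, cosN, sinN)
       cpi2 spi2; field; rewrite ?oppr_eq0 ?nu0 ?nw0 ?b1.
have [ua ub] := polar_slope a0; have [wa wb] := polar_slope w0.
have dS : det2 u w = u 0 0 * w 0 0 * (slope w - slope u).
  by rewrite dE /slope; field; apply/andP.
have sd : Num.sg (det2 u w) =
    Num.sg (u 0 0 * w 0 0) * Num.sg (atan (slope w) - atan (slope u)).
  rewrite dS sgrM; congr (_ * _).
  case: (ltgtP (slope u) (slope w)) => [h|h|->]; last by rewrite !subrr.
    by rewrite !gtr0_sg ?subr_gt0 ?lt_atan.
  by rewrite !ltr0_sg ?subr_lt0 ?lt_atan.
set f := atan (slope u) in ua ub sd *; set g := atan (slope w) in wa wb sd *.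
move=> g1 g2 f1 f2; apply: signed_angle_uniq => //.
  move: d0; rewrite -sgr_eq0 sd sgrM.
  by case: (sgrP (u 0 0)) a0 => // _ _; case: (sgrP (w 0 0)) w0 => // _ _;
    case: (sgrP (g - f)) => h; rewrite ?mulr0 ?eqxx // => _;
    apply/andP; split; lra.
have sa : Num.sg (u 0 0 * w 0 0) = Num.sg (u 0 0) * Num.sg (w 0 0).
  exact: sgrM.
have -> : dot2 u w / (norm2 u * norm2 w) =
    Num.sg (u 0 0 * w 0 0) * cos (g - f).
  rewrite sa dot2E cosB; set su := Num.sg (u 0 0) in ua ub *.
  set sw := Num.sg (w 0 0) in wa wb *.
  by rewrite ua ub wa wb; field; apply/andP.
have cosDpi t : cos (t + pi) = - cos t by rewrite cosD cospi sinpi; ring.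
have cosNpi t : cos (t - pi) = - cos t by rewrite -[t in RHS](subrK pi) cosDpi opprK.
have : Num.sg (u 0 0 * w 0 0) != 0 by rewrite sgr_eq0 mulf_neq0.
have : Num.sg (det2 u w) != 0 by rewrite sgr_eq0.
case: (sgrP (u 0 0 * w 0 0)); rewrite ?eqxx // => _;
  rewrite ?subrr ?mulr0 ?addr0 ?mul1r // mulN1r opprK.
have -> : pi / 2 * (Num.sg (det2 u w) * (1 + 1)) = Num.sg (det2 u w) * pi.
  by move=> *; field.
by case: (sgrP (det2 u w)); rewrite ?eqxx // ?mul1r ?mulN1r ?cosDpi ?cosNpi.
Qed.

Lemma has_signatureE (R : rcfType) n (A : 'M[R]_n) s :
  A^T = A -> has_signature A s -> signature A = s.
Proof. by move=> symA [M [d [uM E ->]]]; exact: signature_congr uM E. Qed.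

Lemma rotation_number_slope (R : realType) n (v : n.+2.-tuple 'cV[R]_2) :
  (forall i : nat, (i <= n)%N -> det2 v`_i v`_i.+1 != 0) ->
  4 * rotation_number v =
    2 / pi * (atan (slope v`_n.+1) - atan (slope v`_0)) + 1 +
    \sum_(i < n.+1) Num.sg (det2 v`_i v`_i.+1) *
      (1 - Num.sg ((v`_i : 'cV[R]_2) 0 0 * (v`_i.+1 : 'cV[R]_2) 0 0)).
Proof.
move=> d0; rewrite /rotation_number.
rewrite (eq_bigr _ (fun (i : 'I_n.+1) _ =>
  signed_angle_slope (d0 i (ltn_ord i)))) big_split -mulr_sumr /=.
rewrite -(big_mkord xpredT (fun i => atan (slope v`_i.+1) - atan (slope v`_i))).
rewrite telescope_sumr //; have := lt0r_neq0 (pi_gt0 R).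
by move: pi => p p0; field.
Qed.

Theorem theorem1p1 (R : realType) (n : nat) (v : n.+2.-tuple 'cV[R]_2)
    (n_ge1 : (1 <= n)%N)
    (v_first : v`_0 = vec2 0 1)
    (v_last : v`_n.+1 = vec2 1 0)
    (v_det : forall i : nat, (i <= n)%N -> det2 v`_i v`_i.+1 != 0) :
  (signature (vec_matrix v))%:~R = 4 * rotation_number v - (sgn_sum v)%:~R.
Proof.
pose a k := (v`_k.+1 : 'cV[R]_2) 0 0; pose b k := (v`_k.+1 : 'cV[R]_2) 1 0.
have a0 : a 0%N != 0.
  have := v_det 0%N isT; rewrite det2E v_first !mxE /= mul0r mul1r sub0r.
  by rewrite oppr_eq0.
have bn : b n = 0 by rewrite /b v_last mxE.
have d0 i : (i < n)%N -> a i * b i.+1 - b i * a i.+1 != 0.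
  by move=> /v_det; rewrite det2E.
have AE : vec_matrix v = green_mx n a b by apply/matrixP => i j; rewrite !mxE.
rewrite AE (has_signatureE (green_mx_sym n a b) (green_mx_signature a0 bn d0)).
rewrite (rotation_number_slope v_det) v_first v_last.
have slope_axis : slope (vec2 0 1 : 'cV[R]_2) = 0 /\ slope (vec2 1 0 : 'cV[R]_2) = 0.
  by rewrite /slope !mxE /= invr0 mulr0 mul0r.
rewrite slope_axis.1 slope_axis.2 subrr mulr0 add0r.
rewrite /sgn_sum rmorphN rmorphD rmorph1 /= !rmorph_sum /=.
rewrite (eq_bigr _ (fun (i : 'I_n.+1) _ => esym (sgrEz (det2 v`_i v`_i.+1)))).
rewrite opprD addrACA subrr add0r -sumrB.
under [RHS]eq_bigr => i _ do rewrite mulrBr mulr1 addrAC subrr add0r.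
rewrite big_ord_recl /= v_first [vec2 0 1 0 0]mxE /= mul0r sgr0 mulr0 oppr0.
rewrite add0r -sumrN.
apply: eq_bigr => i _; rewrite rmorphM /= -!sgrEz -/(a i) -/(a i.+1).
by rewrite det2E.
Qed.
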